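(* Every graph $G$ has a subdivision $H$ with $\pi(H)\leq 4$.
   Context: All graphs are simple, finite and undirected. A path in $H$ is a sequence $v_1,\dots,v_t$ of pairwise distinct vertices with $v_iv_{i+1}\in E(H)$ for all $1\le i\le t-1$. A colouring $f$ of $H$ (a function assigning a colour to each vertex) repetitively colours a path $v_1,\dots,v_{2t}$ ($t\ge 1$) if $f(v_i)=f(v_{t+i})$ for all $i\in\{1,\dots,t\}$. $\pi(H)$ is the minimum $k$ such that $H$ has a colouring with $k$ colours for which no path of $H$ is repetitively coloured. A subdivision of $G$ is a graph obtained from $G$ by subdividing each edge some number (possibly zero, and possibly depending on the edge) of times, i.e. by replacing each edge by a path with the same endpoints, the internal vertices of these paths being new and pairwise distinct. *)

(* Defs.v *)
From mathcomp Require Import all_boot.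

Set Implicit Arguments.
Unset Strict Implicit.
Unset Printing Implicit Defensive.

Record sgraph := SGraph {
  vertex :> finType;
  edge : rel vertex;
  edge_sym : symmetric edge;
  edge_irr : irreflexive edge
}.

Section Nonrepetitive.
Variable H : sgraph.

Definition is_path (s : seq H) : bool := uniq s && sorted (@edge H) s.

Section Colouring.
Variables (C : eqType) (f : H -> C).

Definition repetitively_coloured (s : seq H) : bool :=
  let t := (size s)./2 in
  [&& 0 < t, size s == t.*2 & map f (take t s) == map f (drop t s)].

Definition nonrepetitive : Prop :=
  forall s : seq H, is_path s -> ~~ repetitively_coloured s.

(* Vertices of a path are distinct, so finitely many sequences need testing. *)
Definition nonrepetitiveb : bool :=
  [forall n : 'I_#|H|.+1, forall s : n.-tuple H,
     is_path s ==> ~~ repetitively_coloured s].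

Lemma nonrepetitiveP : reflect nonrepetitive nonrepetitiveb.
Proof.
apply: (iffP forallP) => [h s sP | h n]; last first.
  by apply/forallP => s; apply/implyP; apply: h.
have sz : size s < #|H|.+1.
  by have /andP[/card_uniqP <- _] := sP; rewrite ltnS max_card.
by have /forallP/(_ (in_tuple s))/implyP := h (Ordinal sz); apply.
Qed.

End Colouring.

Definition nonrep_colourable (k : nat) : bool :=
  [exists f : {ffun H -> 'I_k}, nonrepetitiveb f].

Lemma nonrep_colourableP (k : nat) :
  reflect (exists f : H -> 'I_k, nonrepetitive f) (nonrep_colourable k).
Proof.
apply: (iffP existsP) => [[f /nonrepetitiveP fP] | [f fP]]; first by exists f.
exists (finfun f); apply/nonrepetitiveP => s /fP.
by rewrite /repetitively_coloured !(eq_map (ffunE f)).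
Qed.

Lemma nonrep_colourable_card : exists k, nonrep_colourable k.
Proof.
exists #|H|; apply/nonrep_colourableP; exists enum_rank => s /andP[us _].
apply/negP; rewrite /repetitively_coloured; set t := _./2.
case/and3P=> t0 /eqP sz /eqP /(inj_map enum_rank_inj) eq_td.
have szt : size (take t s) = t by rewrite size_takel // sz -addnn leq_addr.
move: us; rewrite -(cat_take_drop t s) -eq_td cat_uniq => /and3P[_ + _].
move: (take t s) szt t0 => [/= <- //|x u _ _] /hasPn/(_ x).
by rewrite mem_head => /(_ isT).
Qed.

Definition nonrep_chromatic_number : nat := ex_minn nonrep_colourable_card.

End Nonrepetitive.

(* [b] embeds the vertices of [G] in [H]. For an edge xy of [G], [P x y] lists,
   from x to y, the internal vertices of the path replacing xy; each edge is
   seen in both orientations, and the two lists are reverses of each other.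
   [P x y] is unconstrained when xy is not an edge. *)
Record subdivision_data (G H : sgraph) (b : G -> H) (P : G -> G -> seq H) :
    Prop := SubdivisionData {
  sd_inj : injective b;
  sd_rev : forall x y, edge x y -> P y x = rev (P x y);
  sd_path : forall x y, edge x y -> is_path (b x :: rcons (P x y) (b y));
  sd_new : forall x y z, edge x y -> b z \notin P x y;
  sd_disj : forall x y x' y' v, edge x y -> edge x' y' ->
    v \in P x y -> v \in P x' y' ->
    (x' = x /\ y' = y) \/ (x' = y /\ y' = x);
  sd_vertex : forall v, (exists x, v = b x) \/
    (exists x y, edge x y /\ v \in P x y);
  sd_edge : forall u v, edge u v -> exists x y,
    edge x y /\ infix [:: u; v] (b x :: rcons (P x y) (b y))
}.

Definition subdivision (G H : sgraph) : Prop :=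
  exists (b : G -> H) (P : G -> G -> seq H), subdivision_data b P.

(* Main.v *)
Require Import Defs.
From mathcomp Require Import all_boot.
From mathcomp Require Import zify.

Set Implicit Arguments.
Unset Strict Implicit.
Unset Printing Implicit Defensive.

(** Subdivide every edge of [G] the same odd number [L = 2M + 1] of times. Give
    all original vertices (branch vertices) colour 3, and colour the inside of
    each edge by a window of a fixed infinite square-free word over the letters
    0, 1, 2. The windows start at distinct positions within distance [M] of one
    another, all start with the letter 1 and all end with the letter 2
    ([windows]).

    The point of this choice is that two different oriented edges (darts) never
    carry the same colours along their first [M + 1] inner vertices, that is,
    along more than half of their length ([dart_prefix]): if one is read forwards
    and the other backwards, the first letters 1 and 2 differ; if both are read
    in the same direction, agreement would make the square-free word repeat
    itself at a shift of at most [M], which gives a square.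

    Let [g 0, ..., g (2t - 1)] be a repetitively coloured path. If it has no
    branch vertex, it runs straight along the inside of one edge and exhibits a
    square in a window ([no_branch_no_square]). Otherwise, since colour 3 marks
    the branch vertices, some [p < t] has both [g p] and [g (t + p)] branch
    vertices. After a branch vertex the path runs along one dart, so its next [L]
    vertices are not branch vertices and [t >= L + 1]. Reversing the path
    replaces [p] by [t - 1 - p], so we may assume [2p < t]; then both halves
    continue for at least [M + 1] vertices after [g p] and [g (t + p)]. The two
    darts that are entered there are different, because the vertices of a path
    are distinct, but show the same colours on their first [M + 1] inner
    vertices, a contradiction ([no_early_branch_square]).

    The square-free word is Thue's: its letter at [n] is the difference of the
    terms [n] and [n + 1] of the Thue-Morse sequence, which contains no
    overlap. *)

(** * The Thue-Morse sequence *)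

(** Parity of the number of binary digits 1 of [n]; [k] bounds the recursion and
    any [k >= n] is enough. *)
Fixpoint tm_rec k n := if k is k'.+1 then odd n (+) tm_rec k' n./2 else false.
Definition tm n := tm_rec n n.

Lemma tm_rec_fuel k l n : n <= k -> n <= l -> tm_rec k n = tm_rec l n.
Proof.
have tm0 j : tm_rec j 0 = false by elim: j.
elim: k l n => [|k IH] l n.
  by rewrite leqn0 => /eqP-> _; rewrite tm0.
case: l => [|l]; first by rewrite leqn0 => _ /eqP->; rewrite tm0.
move=> nk nl /=; congr (_ (+) _); apply: IH; lia.
Qed.

Lemma tm_half n : tm n = odd n (+) tm n./2.
Proof.
case: n => [|n] //; rewrite {1}/tm /=; congr (_ (+) _).
by apply: tm_rec_fuel; rewrite ?leqnn //; lia.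
Qed.

Lemma tm_double n : tm n.*2 = tm n.
Proof. by rewrite tm_half odd_double doubleK. Qed.

Lemma tm_doubleS n : tm n.*2.+1 = ~~ tm n.
Proof. by rewrite tm_half /= odd_double uphalf_double. Qed.

(** Adding [2 ^ r] puts one more digit 1 in front of the binary expansion. *)
Lemma tm_add_pow2 r k : k < 2 ^ r -> tm (2 ^ r + k) = ~~ tm k.
Proof.
elim: r k => [|r IH] k; first by rewrite expn0 ltnS leqn0 => /eqP->.
rewrite expnS mul2n => kr; rewrite tm_half [tm k]tm_half.
rewrite oddD odd_double /= halfD odd_double doubleK /= add0n.
by rewrite IH ?addbN // ltn_half_double.
Qed.

(** Of the pairs at [n] and [n + 1], one starts at an even position [2k], and the
    two entries at [2k] and [2k + 1] are opposite. *)
Lemma tm_cubefree n : tm n = tm n.+1 -> tm n.+1 = tm n.+2 -> False.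
Proof.
rewrite -[n]odd_double_half; case: (odd n); rewrite ?add1n ?add0n.
  by rewrite -doubleS tm_doubleS !tm_double tm_doubleS => _; case: (tm _).
by rewrite tm_doubleS tm_double; case: (tm _).
Qed.

Lemma tm_repeat_odd n : tm n = tm n.+1 -> odd n.
Proof.
apply: contra_eqT => even_n; rewrite -[n]odd_double_half (negbTE even_n) add0n.
by rewrite tm_doubleS tm_double; case: (tm _).
Qed.

(** Five consecutive alternating entries would contain three equal ones at
    positions of the same parity, and halving turns these into three equal
    consecutive entries. *)
Lemma tm_repeat_near n : exists2 k, k < 4 & tm (n + k) = tm (n + k).+1.
Proof.
suff: [exists k : 'I_4, tm (n + k) == tm (n + k).+1].
  by case/existsP=> k /eqP; exists k.
apply: contraT; rewrite negb_exists => /forallP alt.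
have {}alt k : k < 4 -> tm (n + k).+1 = ~~ tm (n + k).
  by move=> k4; have := alt (Ordinal k4) => /=; case: (tm (n + k)); case: (tm _).
have := alt 0 isT; have := alt 1 isT; have := alt 2 isT; have := alt 3 isT.
rewrite !addnS addn0 => e3 e2 e1 e0.
have {}e2: tm n.+4 = tm n.+2 by rewrite e3 e2 negbK.
have {}e0: tm n.+2 = tm n by rewrite e1 e0 negbK.
exfalso; move: e0 e2; rewrite -[n]odd_double_half; case: (odd n) => /=.
  rewrite add1n -!doubleS !tm_doubleS => /negb_inj e0 /negb_inj e2.
  by apply: (@tm_cubefree n./2).
rewrite add0n -!doubleS !tm_double => e0 e2.
by apply: (@tm_cubefree n./2).
Qed.

(** Descent on the period [p]. If [p] is even, the entries of the overlap at
    positions of one parity form an overlap of period [p / 2]. If [p] is odd and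
    larger than 1, a pair of equal neighbours near the start of the overlap,
    shifted by [p], is again such a pair; but those occur at odd positions only. *)
Lemma tm_overlapfree p n :
  0 < p -> ~ (forall i, i <= p -> tm (n + i) = tm (n + p + i)).
Proof.
elim/ltn_ind: p n => p IH n p0 per.
have [podd|peven] := boolP (odd p); last first.
  apply: (IH p./2 _ n./2); [lia | lia |] => i ip.
  (* [n + 2i] and [n + p + 2i] have the same parity, which cancels below *)
  have /per: i.*2 <= p by lia.
  rewrite tm_half [in RHS]tm_half !oddD odd_double (negbTE peven) !addbF.
  have -> : (n + i.*2)./2 = n./2 + i by lia.
  have -> : (n + p + i.*2)./2 = n./2 + p./2 + i by lia.
  by move/addbI.
have [p1|p3] : p = 1 \/ 2 < p by lia.
  subst p; have := per 0 isT; have := per 1 isT; rewrite !addn0 !addn1.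
  by move=> e1 e0; apply: tm_cubefree e0 e1.
have [k k4 rep] := tm_repeat_near n.
have odd1 := tm_repeat_odd rep.
have [kp|pk] := ltnP k p.
  have e0 := per k (ltnW kp); have := per k.+1 kp; rewrite !addnS -rep e0.
  by move/tm_repeat_odd; rewrite addnAC oddD odd1 podd.
have e0 := per (k - p) ltac:(lia); have e1 := per (k - p).+1 ltac:(lia).
have /tm_repeat_odd : tm (n + (k - p)) = tm (n + (k - p)).+1.
  rewrite e0 -addnS e1 addnS.
  by have -> : n + p + (k - p) = n + k by lia.
by lia.
Qed.

(** * A square-free word over three letters *)

(** The difference [tm n.+1 - tm n], with 2 standing for -1; colour 3 is kept for
    the branch vertices. *)
Definition letter n : 'I_4 :=
  if tm n == tm n.+1 then @Ordinal 4 0 isT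
  else if tm n then @Ordinal 4 2 isT else @Ordinal 4 1 isT.

Definition branch_colour : 'I_4 := @Ordinal 4 3 isT.

Lemma letter_neq_branch n : letter n != branch_colour.
Proof. by rewrite /letter; case: (tm n) (tm n.+1) => [] []. Qed.

(** Equal differences carry equality of the Thue-Morse entries one step further;
    if the entries differ, the common difference can only be 0. *)
Lemma letter_step m n : letter m = letter n ->
  if tm m == tm n then tm m.+1 = tm n.+1
  else tm m.+1 = tm m /\ tm n.+1 = tm n.
Proof.
by rewrite /letter; case: (tm m) (tm n) (tm m.+1) (tm n.+1) => [] [] [] [].
Qed.

(** Summing the differences over each half of a square shows that
    [tm (n + p) - tm n] equals [tm (n + 2p) - tm (n + p)]; as the entries are 0
    or 1 this number is 0, so the square lifts to an overlap of the Thue-Morse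
    sequence. *)
Lemma letter_squarefree n p :
  0 < p -> ~ (forall i, i < p -> letter (n + i) = letter (n + p + i)).
Proof.
move=> p0 sq; have [eqt|neqt] := boolP (tm n == tm (n + p)).
  apply: (tm_overlapfree (n := n) p0); elim=> [|i IH] ip.
    by rewrite !addn0; apply/eqP.
  have := letter_step (sq i ip); rewrite (IH (ltnW ip)) eqxx.
  by rewrite !addnS.
(* two different entries stay different and constant, yet the first block ends
   where the second begins *)
suff /(_ p (leqnn p)) [e _] : forall i, i <= p ->
    tm (n + i) = tm n /\ tm (n + p + i) = tm (n + p).
  by rewrite e eqxx in neqt.
elim=> [|i IH] ip; first by rewrite !addn0.
have [e1 e2] := IH (ltnW ip).
have := letter_step (sq i ip); rewrite e1 e2 (negbTE neqt) => -[e3 e4].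
by rewrite !addnS e3 e4.
Qed.

(** A square read from right to left is a square. *)
Lemma letter_squarefree_rev n p : p.*2 <= n.+1 ->
  0 < p -> ~ (forall i, i < p -> letter (n - i) = letter (n - (p + i))).
Proof.
move=> pn p0 sq; apply: (@letter_squarefree (n.+1 - p.*2) p p0) => i ip.
have := sq (p - i.+1) ltac:(lia).
have -> : n - (p - i.+1) = n.+1 - p.*2 + p + i by lia.
by have -> : n - (p + (p - i.+1)) = n.+1 - p.*2 + i by lia.
Qed.

(** Blocks of length four of the Thue-Morse sequence are 0110 or 1001, so the
    entry at [k] alone decides the letter at [4k]. *)
Lemma letter_quad k : letter (4 * k) = (tm k).+1 :> nat.
Proof.
have -> : 4 * k = k.*2.*2 by lia.
by rewrite /letter tm_doubleS !tm_double; case: (tm k).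
Qed.

(** One of the Thue-Morse entries at [2i] and [2i + 1] is 0; let [k] be its
    position. The [i]-th window starts at [4k] and ends at [4(k + 2 ^ r)], where
    the entry is 1. A large [r] makes the windows long compared with the
    distances between their starts. *)
Lemma windows m : exists M (s : nat -> nat), forall i, i < m ->
  [/\ letter (s i) = 1 :> nat, letter (s i + M.*2) = 2 :> nat
    & forall j, i < j < m -> s i < s j <= s i + M].
Proof.
pose start i := 4 * (i.*2 + tm i).
exists (2 * 2 ^ m.+2), start => i im; have mr : 4 * m < 2 ^ m.+2.
  by rewrite !expnS; have := ltn_expl m (isT : 1 < 2); lia.
have tm0 : tm (i.*2 + tm i) = false.
  by case E: (tm i); rewrite ?addn0 ?addn1 ?tm_doubleS ?tm_double E.
split; first by rewrite letter_quad tm0.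
  have -> : start i + (2 * 2 ^ m.+2).*2 = 4 * (2 ^ m.+2 + (i.*2 + tm i)).
    by rewrite /start; lia.
  by rewrite letter_quad tm_add_pow2 ?tm0 //; lia.
by move=> j; rewrite /start; lia.
Qed.

(** * The uniform subdivision of a graph *)

Section Construction.

Variable G : sgraph.

(** Each edge is represented once, by its orientation towards the vertex of larger
    rank. *)
Definition oriented_edge (p : G * G) : bool :=
  edge p.1 p.2 && (enum_rank p.1 < enum_rank p.2).

Definition edges : finType := {p : G * G | oriented_edge p}.

(** An edge with a direction of travel, [true] being the representing
    orientation. *)
Definition dart : Type := (edges * bool)%type.

Definition source (d : dart) : G := if d.2 then (val d.1).1 else (val d.1).2.
Definition target (d : dart) : G := if d.2 then (val d.1).2 else (val d.1).1.
Definition flip (d : dart) : dart := (d.1, ~~ d.2).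

Lemma dart_edge d : edge (source d) (target d).
Proof.
case: d => e o; have /andP[exy _] := valP e.
by rewrite /source /target; case: o => //=; rewrite edge_sym.
Qed.

Lemma edge_dart x y : edge x y -> exists d, source d = x /\ target d = y.
Proof.
move=> exy; have [xy|yx|eq_xy] := ltngtP (enum_rank x) (enum_rank y).
- have xyP : oriented_edge (x, y) by rewrite /oriented_edge exy xy.
  by exists (exist oriented_edge _ xyP, true).
- have yxP : oriented_edge (y, x) by rewrite /oriented_edge edge_sym exy yx.
  by exists (exist oriented_edge _ yxP, false).
by have := edge_irr x; rewrite {2}(enum_rank_inj (val_inj eq_xy)) exy.
Qed.

Variable L : nat.

Definition subdiv_vertex : finType := (G + edges * 'I_L)%type.

(** The [k]-th vertex on the path that replaces [e]: its ends are at [k = 0] and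
    [k = L + 1], and the inner vertex [inr (e, i)] is at [k = i + 1]. *)
Definition edge_node (e : edges) (k : nat) : subdiv_vertex :=
  if k is k'.+1 then
    if insub k' : option 'I_L is Some i then inr (e, i) else inl (val e).2
  else inl (val e).1.

Arguments edge_node : simpl never.

Definition node (d : dart) (k : nat) : subdiv_vertex :=
  edge_node d.1 (if d.2 then k else L.+1 - k).

Lemma edge_node_inner e k (kL : k < L) :
  edge_node e k.+1 = inr (e, Ordinal kL).
Proof. by rewrite /edge_node insubT. Qed.

Lemma edge_node_last e : edge_node e L.+1 = inl (val e).2.
Proof. by rewrite /edge_node insubF ?ltnn. Qed.

Lemma node_source d : node d 0 = inl (source d).
Proof. by case: d => e []; [|exact: edge_node_last]. Qed.

Lemma node_target d : node d L.+1 = inl (target d).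
Proof. by case: d => e []; [exact: edge_node_last | rewrite /node subnn]. Qed.

Lemma node_flip d k : k <= L.+1 -> node (flip d) k = node d (L.+1 - k).
Proof. by case: d => e [] kL; rewrite /node /= ?subKn. Qed.

(** The second component of the inner vertex [node d k], meaningful for
    [0 < k <= L]. *)
Definition inner_index (d : dart) k := if d.2 then k.-1 else L - k.

Lemma node_inner d k : 0 < k <= L ->
  exists2 i : 'I_L, node d k = inr (d.1, i) & i = inner_index d k :> nat.
Proof.
case: d => e [] kL; rewrite /node /inner_index /=.
  have iL : k.-1 < L by lia.
  by exists (Ordinal iL) => //; rewrite -edge_node_inner prednK //; lia.
have iL : L - k < L by lia.
by exists (Ordinal iL) => //; rewrite -edge_node_inner subSn //; lia.
Qed.

Lemma node_inner_inj d d' k k' : 0 < k <= L -> 0 < k' <= L ->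
  node d k = node d' k' -> d.1 = d'.1 /\ inner_index d k = inner_index d' k'.
Proof.
move=> /(node_inner d)[i -> <-] /(node_inner d')[i' -> <-] eq_n.
by move: eq_n; case=> -> ->.
Qed.

Lemma inner_node_neq d k x : 0 < k <= L -> node d k <> inl x.
Proof. by move=> /(node_inner d)[i ->]. Qed.

Lemma node_inj d k k' : k <= L.+1 -> k' <= L.+1 -> node d k = node d k' -> k = k'.
Proof.
have source_target : source d <> target d.
  by move=> eq_th; have := dart_edge d; rewrite eq_th edge_irr.
have caseP j : j <= L.+1 -> j = 0 \/ 0 < j <= L \/ j = L.+1 by lia.
move=> /caseP[->|[kI|->]] /caseP[->|[k'I|->]];
  rewrite ?node_source ?node_target //.
- by move/esym/(inner_node_neq k'I).
- by move=> [].
- by move/(inner_node_neq kI).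
- by case/(node_inner_inj kI k'I)=> _; rewrite /inner_index; case: d.2; lia.
- by move/(inner_node_neq kI).
- by move=> [] /esym.
by move/esym/(inner_node_neq k'I).
Qed.

Definition subdiv_edge (u v : subdiv_vertex) : bool :=
  [exists e : edges, exists k : 'I_L.+1,
     let a := edge_node e k in let b := edge_node e k.+1 in
     (u == a) && (v == b) || (v == a) && (u == b)].

Lemma subdiv_edgeP u v : reflect
  (exists d k, [/\ k <= L, u = node d k & v = node d k.+1]) (subdiv_edge u v).
Proof.
apply: (iffP existsP) => [[e /existsP[k /orP[] /andP[/eqP-> /eqP->]]]|].
- by exists (e, true), k; split=> //; rewrite -ltnS.
- exists (e, false), (L - k); have := ltn_ord k; rewrite ltnS => kL.
  split; rewrite ?leq_subr // /node /=; congr (edge_node _ _); lia.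
move=> [[e o] [k [kL -> ->]]]; exists e; apply/existsP.
case: o; first by exists (inord k); rewrite /= inordK // !eqxx.
exists (inord (L - k)); rewrite /= inordK ?ltnS ?leq_subr //.
by rewrite /node /= subSS subSn // !eqxx orbT.
Qed.

Lemma subdiv_edge_sym : symmetric subdiv_edge.
Proof.
move=> u v; apply: eq_existsb => e; apply: eq_existsb => k /=.
by rewrite orbC.
Qed.

Lemma subdiv_edge_irr : irreflexive subdiv_edge.
Proof.
move=> u; apply/subdiv_edgeP=> -[d [k [kL -> /node_inj]]].
by rewrite leqW // ltnS => /(_ isT kL) /n_Sn.
Qed.

Definition subdiv_graph : sgraph := SGraph subdiv_edge_sym subdiv_edge_irr.

Definition inner_path (d : dart) : seq subdiv_graph :=
  mkseq (fun k => node d k.+1) L.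

Definition edge_path (x y : G) : seq subdiv_graph :=
  if insub (x, y) : option edges is Some e then inner_path (e, true) else
  if insub (y, x) : option edges is Some e then inner_path (e, false) else [::].

Lemma edge_path_dart d : edge_path (source d) (target d) = inner_path d.
Proof.
case: d => e [] /=; rewrite /edge_path /source /target /=.
  by rewrite -surjective_pairing valK.
rewrite -surjective_pairing valK insubF //.
by have /andP[_ lt] := valP e; rewrite /oriented_edge /= ltnNge ltnW ?andbF.
Qed.

Lemma full_path d :
  inl (source d) :: rcons (inner_path d) (inl (target d)) = mkseq (node d) L.+2.
Proof.
rewrite mkseqS node_target -[mkseq _ L.+1]/(node d 0 :: map (node d) (iota 1 L)).
by rewrite node_source (iotaDl 1 0) -map_comp.
Qed.

Lemma inner_path_flip d : inner_path (flip d) = rev (inner_path d).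
Proof.
apply: (@eq_from_nth _ (node d 0)); rewrite ?size_rev ?size_mkseq // => i iL.
rewrite nth_rev ?size_mkseq // !nth_mkseq //; last lia.
by rewrite node_flip ?subSn // ltnW.
Qed.

Lemma mem_inner_path d v :
  reflect (exists2 k, 0 < k <= L & v = node d k) (v \in inner_path d).
Proof.
apply: (iffP mapP) => [[k]|[[|k] // kL ->]].
  by rewrite mem_iota => /andP[_ kL] ->; exists k.+1.
by exists k; rewrite // mem_iota.
Qed.

Lemma infix_mkseq2 (T : eqType) (f : nat -> T) n k : k.+1 < n ->
  infix [:: f k; f k.+1] (mkseq f n).
Proof.
move=> kn; apply/infixP; exists (mkseq f k), (map f (iota k.+2 (n - k.+2))).
by rewrite /mkseq -[n in LHS](subnKC kn) -addn2 -addnA !iotaD !map_cat.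
Qed.

Lemma subdiv_graph_subdivision : subdivision G subdiv_graph.
Proof.
exists (inl : G -> subdiv_graph), edge_path.
split=> [x y []//|x y|x y|x y z|x y x' y' v|v|u v].
- case/edge_dart=> d [<- <-]; rewrite edge_path_dart -inner_path_flip.
  rewrite -edge_path_dart; congr edge_path; by rewrite /source /target /=; case: d.2.
- case/edge_dart=> d [<- <-]; rewrite edge_path_dart full_path /is_path.
  apply/andP; split.
    by apply/mkseq_uniqP=> k k' kL k'L; apply: node_inj.
  apply/(sortedP (node d 0)) => k; rewrite size_mkseq => kL.
  rewrite !nth_mkseq ?(ltnW kL) //; apply/subdiv_edgeP; by exists d, k.
- case/edge_dart=> d [<- <-]; rewrite edge_path_dart; apply/negP.
  by case/mem_inner_path=> k kL /esym /(inner_node_neq kL).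
- case/edge_dart=> d [<- <-] /edge_dart[d' [<- <-]]; rewrite !edge_path_dart.
  case/mem_inner_path=> k kL -> /mem_inner_path[k' k'L].
  case/(node_inner_inj kL k'L); case: d d' {kL k'L} => e o [e' o'] /= <- _.
  by case: o o' => [] []; rewrite /source /target /=; by [left|right].
- case: v => [x|[e i]]; [by left; exists x | right].
  exists (val e).1, (val e).2; have := dart_edge (e, true); split=> //.
  rewrite (edge_path_dart (e, true)); apply/mem_inner_path.
  by exists i.+1; rewrite ?ltn_ord // /node /edge_node /= valK.
case/subdiv_edgeP=> d [k [kL -> ->]]; exists (source d), (target d).
split; first exact: dart_edge.
by rewrite edge_path_dart full_path; apply: infix_mkseq2.
Qed.

(** * Paths in the subdivision *)

Lemma subdiv_edge_branch x v :
  subdiv_edge (inl x) v -> exists d, inl x = node d 0 /\ v = node d 1.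
Proof.
case/subdiv_edgeP=> d [[|k] [kL eq_u ->]]; first by exists d.
by case: (@inner_node_neq d k.+1 x).
Qed.

(** An inner vertex lies on the two darts of a single edge, and flipping a dart
    exchanges the neighbours at [k - 1] and [k + 1]. *)
Lemma subdiv_edge_inner d k v : 0 < k <= L -> subdiv_edge (node d k) v ->
  v = node d k.-1 \/ v = node d k.+1.
Proof.
move=> kI /subdiv_edgeP[d' [[|k'] [k'L eq_u ->]]].
  by case: (@inner_node_neq d k (source d')); rewrite // eq_u node_source.
have k'I : 0 < k'.+1 <= L by [].
have [] := node_inner_inj kI k'I eq_u.
case: d d' {eq_u} => e o [e' o'] /= <-; rewrite /inner_index /=.
have [<-|] := eqVneq o o'.
  move=> eq_k; right; congr (node _ _); move: eq_k; case: o; lia.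
move=> neq_o eq_k; left; have -> : (e, o') = flip (e, o).
  by move: neq_o; rewrite /flip; case: o o' {eq_k} => [] [].
rewrite node_flip; last lia; congr (node _ _).
by move: neq_o eq_k; case: o o' => [] [] //=; lia.
Qed.

(** A path given by its enumeration: indexing makes reversal and runs from the
    middle of a path easy to express. *)
Definition traversal n (g : nat -> subdiv_graph) :=
  (forall i, i.+1 < n -> edge (g i) (g i.+1)) /\
  (forall i j, i < n -> j < n -> g i = g j -> i = j).

Lemma traversal_rev n g : traversal n g -> traversal n (fun i => g (n - i.+1)).
Proof.
move=> [ge gi]; split=> [i iN | i j iN jN /gi].
  by rewrite edge_sym; have := ge (n - i.+2); rewrite -subSn //; apply; lia.
lia.
Qed.

(** At an inner vertex a path cannot turn back to the vertex it came from, so it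
    goes straight on until the end of the dart. *)
Lemma traversal_run n g d i k : traversal n g ->
  g i = node d k -> g i.+1 = node d k.+1 ->
  forall j, i + j < n -> k + j <= L.+1 -> g (i + j) = node d (k + j).
Proof.
move=> [ge gi] gk gk1; elim/ltn_ind=> -[|[|j]] IH iN kL.
- by rewrite !addn0.
- by rewrite !addn1.
have e1 : g (i + j.+1) = node d (k + j.+1) by apply: IH; lia.
have e0 : g (i + j) = node d (k + j) by apply: IH; lia.
have := ge (i + j.+1); rewrite -addnS e1 => /(_ iN)/subdiv_edge_inner.
case; [lia | | by rewrite -addnS].
have -> : (k + j.+1).-1 = k + j by lia.
by rewrite -e0 => /gi; lia.
Qed.

End Construction.

(** * The colouring and its repetitions *)

Section Colouring.

Variables (G : sgraph) (M : nat) (start : edges G -> nat).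

Local Notation L := M.*2.+1.
Local Notation H := (subdiv_graph G L).

Hypothesis start_letter : forall e, letter (start e) = 1 :> nat.
Hypothesis end_letter : forall e, letter (start e + M.*2) = 2 :> nat.
Hypothesis start_close : forall e e', e != e' ->
  start e < start e' <= start e + M \/ start e' < start e <= start e' + M.

Definition colour (v : H) : 'I_4 :=
  if v is inr (e, i) then letter (start e + i) else branch_colour.

Lemma colour_node d k : 0 < k <= L ->
  colour (node L d k) = letter (start d.1 + inner_index L d k).
Proof. by move=> /(node_inner d)[i -> <-]. Qed.

Lemma dart_squarefree d k p : 0 < p -> 0 < k -> k + p.*2 <= L.+1 ->
  ~ (forall i, i < p ->
       colour (node L d (k + i)) = colour (node L d (k + (p + i)))).
Proof.
move=> p0 k0 kL sq.
have {}sq i : i < p -> letter (start d.1 + inner_index L d (k + i)) =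
                       letter (start d.1 + inner_index L d (k + (p + i))).
  by move=> ip; have := sq i ip; rewrite !colour_node //; lia.
move: sq; rewrite /inner_index; case: d.2 => sq.
  apply: (@letter_squarefree (start d.1 + k.-1) p p0) => i ip.
  have := sq i ip; congr (letter _ = letter _); lia.
apply: (@letter_squarefree_rev (start d.1 + (L - k)) p _ p0) => [|i ip]; first lia.
have := sq i ip; congr (letter _ = letter _); lia.
Qed.

(** A common prefix of length [M + 1] forces the same direction, by its first
    letter, and then a square whose period is the distance between the two
    windows. *)
Lemma dart_prefix d d' : d != d' ->
  ~ (forall j, j <= M -> colour (node L d j.+1) = colour (node L d' j.+1)).
Proof.
move=> neq_d same.
have {}same j : j <= M -> letter (start d.1 + inner_index L d j.+1) =
                          letter (start d'.1 + inner_index L d' j.+1).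
  by move=> jM; have := same j jM; rewrite !colour_node //; lia.
(* the first letter is 1 in direction [true] and 2 in direction [false] *)
have first b b' e e' : d = (e, b) -> d' = (e', b') -> b = b'.
  move=> ed ed'; have := congr1 val (same 0 isT); rewrite ed ed' /inner_index /=.
  rewrite subSS subn0; case: b b' {ed ed'} => [] [] //.
    by rewrite addn0 start_letter end_letter.
  by rewrite addn0 start_letter end_letter.
wlog lt_start : d d' neq_d same first /
    start d.1 < start d'.1 <= start d.1 + M.
  move=> th; have [|lt|lt] := start_close (e := d.1) (e' := d'.1).
  - apply: contra neq_d; case: d d' first {same th} => e b [e' b'] first /= /eqP eq_e.
    by rewrite eq_e (first _ _ _ _ erefl erefl).
  - exact: (th d d').
  apply: (th d' d) => //; first by rewrite eq_sym.
    by move=> j /same.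
  by move=> b b' e e' ed ed'; rewrite (first _ _ _ _ ed' ed).
case: d d' {neq_d} same first lt_start => e b [e' b'] same first /= lt.
have eq_b := first _ _ _ _ erefl erefl; subst b'.
pose p := start e' - start e; have p0 : 0 < p by lia.
case: b same {first}; rewrite /inner_index /= => same.
  apply: (@letter_squarefree (start e) p p0) => i ip.
  have := same i ltac:(lia); congr (letter _ = letter _); lia.
apply: (@letter_squarefree_rev (start e' + M.*2) p _ p0) => [|i ip]; first lia.
have := same i ltac:(lia) => /esym; congr (letter _ = letter _); lia.
Qed.

Definition is_branch (v : H) : bool := if v is inl _ then true else false.

Lemma is_branch_colour v : is_branch v = (colour v == branch_colour).
Proof. by case: v => [x|[e i]] /=; rewrite ?eqxx // (negbTE (letter_neq_branch _)). Qed.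

Lemma is_branch_node d k : 0 < k <= L -> is_branch (node L d k) = false.
Proof. by move=> /(node_inner d)[i ->]. Qed.

Lemma traversal_from_branch n g i : traversal n g -> i.+1 < n -> is_branch (g i) ->
  exists d, forall j, i + j < n -> j <= L.+1 -> g (i + j) = node L d j.
Proof.
move=> tr iN; case E: (g i) => [x|//] _.
have := tr.1 i iN; rewrite E => /subdiv_edge_branch[d [e0 e1]].
by exists d => j; apply: (traversal_run tr _ e1 (k := 0)); rewrite E.
Qed.

(** Without branch vertices the path never reaches the end of the dart on which
    it starts, so that all its colours are read along this dart. *)
Lemma no_branch_no_square t g : 0 < t -> traversal t.*2 g ->
  (forall i, i < t.*2 -> ~~ is_branch (g i)) ->
  ~ (forall i, i < t -> colour (g i) = colour (g (t + i))).
Proof.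
move=> t0 tr nobr sq.
have [d [k [kL e0 e1]]] : exists d k, [/\ k <= L, g 0 = node L d k & g 1 = node L d k.+1].
  by apply/subdiv_edgeP; apply: tr.1; lia.
have k0 : 0 < k.
  by case: k e0 {kL e1} => // e0; have := nobr 0; rewrite e0 node_source double_gt0 => /(_ t0).
have kt : k + t.*2 <= L.+1.
  have [//|lt] := leqP; have := nobr (L.+1 - k).
  rewrite -[L.+1 - k]add0n (traversal_run tr e0 e1); [|lia|lia].
  by rewrite subnKC ?node_target; [move/(_ ltac:(lia))|lia].
apply: (@dart_squarefree d k t t0 k0 kt) => i it.
rewrite -!(traversal_run tr e0 e1) ?add0n; [exact: sq|lia..].
Qed.

(** The condition on [p] leaves, once [t > L] is known, room for [M + 1] vertices
    after [g p] in the first half and after [g (t + p)] in the second. *)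
Lemma no_early_branch_square t g p : traversal t.*2 g ->
  p.*2 < t -> is_branch (g p) ->
  ~ (forall i, i < t -> colour (g i) = colour (g (t + i))).
Proof.
move=> tr pt br sq.
have brt : is_branch (g (t + p)) by rewrite is_branch_colour -sq -?is_branch_colour //; lia.
have [d run] := traversal_from_branch tr (i := p) ltac:(lia) br.
(* two branch vertices of a path are more than [L] steps apart *)
have Lt : L < t.
  have [//|tL] := ltnP; move: brt; rewrite addnC run ?is_branch_node; lia.
have [d' run'] := traversal_from_branch tr (i := t + p) ltac:(lia) brt.
apply: (@dart_prefix d d') => [|j jM].
  apply/eqP=> eq_d; have := run' 1 ltac:(lia) isT; rewrite -eq_d -run //; last lia.
  by move/tr.2; lia.
rewrite -run; [|lia|lia]; rewrite -run'; [|lia|lia].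
by rewrite -addnA sq //; lia.
Qed.

Lemma colour_nonrepetitive : nonrepetitive colour.
Proof.
move=> s /andP[us es]; apply/negP=> /and3P[]; set t := _./2 => t0 /eqP sz /eqP eq_s.
have x0 : H by move: t0; rewrite /t; case: (s).
pose g i := nth x0 s i.
have tr : traversal t.*2 g.
  split=> [i iN | i j iN jN]; first by move/(sortedP x0): es; apply; rewrite sz.
  by move/eqP; rewrite nth_uniq ?sz // => /eqP.
have sq i : i < t -> colour (g i) = colour (g (t + i)).
  move=> it; have := congr1 (nth branch_colour ^~ i) eq_s.
  rewrite (nth_map x0) ?size_takel ?sz //; last lia.
  rewrite (nth_map x0) ?size_drop ?sz //; last lia.
  by rewrite nth_take // nth_drop.
have [/existsP[i0 br]|] := boolP [exists i : 'I_t, is_branch (g i)]; last first.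
  rewrite negb_exists => /forallP nobr; apply: (no_branch_no_square t0 tr _ sq) => i.
  have [it _|ti it2] := ltnP i t; first exact: (nobr (Ordinal it)).
  have it : i - t < t by lia.
  have := nobr (Ordinal it); rewrite /= !is_branch_colour sq //.
  by rewrite subnKC.
case: i0 br => p /= pt br.
(* a late branch vertex becomes an early one in the reversed path *)
have [early|late] := ltnP p.*2 t; first exact: no_early_branch_square tr early br sq.
apply: (no_early_branch_square (traversal_rev tr) (p := t - p.+1)) => [||i it].
- lia.
- have -> : t.*2 - (t - p.+1).+1 = t + p by lia.
  by rewrite is_branch_colour -sq // -is_branch_colour.
have -> : t.*2 - i.+1 = t + (t - i.+1) by lia.
have -> : t.*2 - (t + i).+1 = t - i.+1 by lia.
by apply/esym/sq; lia.
Qed.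

End Colouring.

Theorem theorem4p1 (G : sgraph) :
  exists H : sgraph, subdivision G H /\ nonrep_chromatic_number H <= 4.
Proof.
have [M [s sP]] := windows #|edges G|.
exists (subdiv_graph G M.*2.+1); split; first exact: subdiv_graph_subdivision.
rewrite /nonrep_chromatic_number; case: ex_minnP => m _; apply.
apply/nonrep_colourableP.
exists (colour (fun e => s (enum_rank e))).
apply: colour_nonrepetitive => [e|e|e e' neq_e].
- by have [] := sP _ (ltn_ord (enum_rank e)).
- by have [] := sP _ (ltn_ord (enum_rank e)).
have [_ _ lt] := sP _ (ltn_ord (enum_rank e)).
have [_ _ gt] := sP _ (ltn_ord (enum_rank e')).
have : enum_rank e != enum_rank e' :> nat by rewrite (inj_eq val_inj) (inj_eq enum_rank_inj).
by rewrite neq_ltn => /orP[l|l]; [left; apply: lt|right; apply: gt]; rewrite l ltn_ord.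
Qed.
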